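(* Consider the problem $(P_1)$ $\min_{x\in Q}\{f(x): A_1x=b_1,\ A_2x\le b_2\}$, where $f$ is $\nu$-strongly convex on the closed convex set $Q\subseteq E$ with respect to the norm $\|\cdot\|_E$, as specified in the context. Assume that for every $\lambda=(\lambda^{(1)},\lambda^{(2)})\in\Lambda$ the inner problem $\max_{x\in Q}\left(-f(x)-\langle A_1^T\lambda^{(1)}+A_2^T\lambda^{(2)},x\rangle\right)$ can be solved exactly (its unique solution is denoted $x(\lambda)$), and that the Lagrange dual problem $(D_1)$ has a solution $\lambda^*=(\lambda^{*(1)},\lambda^{*(2)})$ with $\|\lambda^{*(1)}\|_2\le R_1$ and $\|\lambda^{*(2)}\|_2\le R_2$ for some finite $R_1,R_2>0$. Let $L=\frac1\nu\left(\|A_1\|_{E\to H_1}^2+\|A_2\|_{E\to H_2}^2\right)>0$, and let $\lambda_k,\eta_k,\zeta_k,\hat x_k$, $k=0,1,2,\dots$, be the sequences generated by the Fast Primal-Dual Gradient Method described in the context with $\alpha_i=\frac{i+1}{2}$, $i\ge 0$. Then: 1. For any $\tilde\varepsilon_f,\tilde\varepsilon_{eq},\tilde\varepsilon_{in}>0$, the stopping criterion $$|f(\hat x_k)+\varphi(\eta_k)|\le\tilde\varepsilon_f,\qquad \|A_1\hat x_k-b_1\|_2\le\tilde\varepsilon_{eq},\qquad \|(A_2\hat x_k-b_2)_+\|_2\le\tilde\varepsilon_{in}$$ is satisfied, and hence the algorithm stops, at some iteration index $k\le N_{stop}$, where $$N_{stop}=\max\left\{\left\lceil\sqrt{\frac{8L(R_1^2+R_2^2)}{\tilde\varepsilon_f}}\right\rceil,\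 \left\lceil\sqrt{\frac{8L(R_1^2+R_2^2)}{R_1\tilde\varepsilon_{eq}}}\right\rceil,\ \left\lceil\sqrt{\frac{8L(R_1^2+R_2^2)}{R_2\tilde\varepsilon_{in}}}\right\rceil\right\}-1.$$ 2. For any $\varepsilon_f,\varepsilon_{eq},\varepsilon_{in}>0$, put $$N=\max\left\{\left\lceil\sqrt{\frac{16L(R_1^2+R_2^2)}{\varepsilon_f}}\right\rceil,\ \left\lceil\sqrt{\frac{8L(R_1^2+R_2^2)}{R_1\varepsilon_{eq}}}\right\rceil,\ \left\lceil\sqrt{\frac{8L(R_1^2+R_2^2)}{R_2\varepsilon_{in}}}\right\rceil\right\}-1.$$ Then the point $\hat x_N$ satisfies $$|f(\hat x_N)-Opt[P_1]|\le\varepsilon_f,\qquad \|A_1\hat x_N-b_1\|_2\le\varepsilon_{eq},\qquad \|(A_2\hat x_N-b_2)_+\|_2\le\varepsilon_{in}.$$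
   Context: **Spaces and norms.** $E$ is a finite-dimensional real vector space with a norm $\|\cdot\|_E$; $H_1,H_2$ are finite-dimensional real Euclidean coordinate spaces with the standard Euclidean norm $\|\cdot\|_2$ (so that the dual norms on $H_1^*,H_2^*$ are also Euclidean and denoted $\|\cdot\|_2$). For a vector space $V$, $V^*$ is its dual and $\langle g,x\rangle$ is the value of $g\in V^*$ at $x\in V$. On $H_1^*\times H_2^*$ one uses $\|\lambda\|_2^2=\|\lambda^{(1)}\|_2^2+\|\lambda^{(2)}\|_2^2$ for $\lambda=(\lambda^{(1)},\lambda^{(2)})$. For a linear operator $A:E\to H$, $\|A\|_{E\to H}=\max\{\langle u,Ax\rangle:\|x\|_E=1,\ u\in H^*,\ \|u\|_2=1\}$, and $A^T:H^*\to E^*$ is the adjoint, $\langle u,Ax\rangle=\langle A^Tu,x\rangle$. Inequalities between vectors are componentwise; $v_+$ is the vector with components $\max\{v_i,0\}$; $\lceil t\rceil$ is the smallest integer greater than or equal to $t$. **Primal problem.** $(P_1)$: $\min_{x\in Q}\{f(x):A_1x=b_1,\ A_2x\le b_2\}$, where $Q\subseteq E$ is a nonempty closed convex set, $A_1:E\to H_1$ and $A_2:E\to H_2$ are linear operators, $b_1\in H_1$, $b_2\in H_2$, and $f:Q\to\mathbb R$ is a convex, lower semicontinuous function that is $\nu$-strongly convex on $Q$ ($\nu>0$) with respect to $\|\cdot\|_E$: for any $x,y\in Q$ and any subgradient $\nabla f(x)\in E^*$ of $f$ at $x$, $f(y)\ge f(x)+\langle\nabla f(x),y-x\rangle+\frac{\nu}{2}\|x-y\|_E^2$.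 $Opt[P_1]$ denotes the optimal value of $(P_1)$. **Dual problem.** Let $\Lambda=\{\lambda=(\lambda^{(1)},\lambda^{(2)})\in H_1^*\times H_2^*:\lambda^{(2)}\ge 0\}$. The Lagrange dual problem is $$(D_1)\quad \max_{\lambda\in\Lambda}\left\{-\langle\lambda^{(1)},b_1\rangle-\langle\lambda^{(2)},b_2\rangle+\min_{x\in Q}\left(f(x)+\langle A_1^T\lambda^{(1)}+A_2^T\lambda^{(2)},x\rangle\right)\right\}.$$ Define $$\varphi(\lambda)=\langle\lambda^{(1)},b_1\rangle+\langle\lambda^{(2)},b_2\rangle+\max_{x\in Q}\left(-f(x)-\langle A_1^T\lambda^{(1)}+A_2^T\lambda^{(2)},x\rangle\right),$$ so that $(D_1)$ is equivalent to minimizing $\varphi$ over $\Lambda$. Let $x(\lambda)$ be the unique maximizer over $Q$ in this definition. The function $\varphi$ is differentiable with gradient $\nabla\varphi(\lambda)=(b_1-A_1x(\lambda),\ b_2-A_2x(\lambda))$, which is Lipschitz continuous with constant $L=\frac1\nu\left(\|A_1\|_{E\to H_1}^2+\|A_2\|_{E\to H_2}^2\right)$. **Algorithm (Fast Primal-Dual Gradient Method).** Given coefficients $\{\alpha_i\}_{i\ge0}$, here $\alpha_i=\frac{i+1}{2}$, put $C_k=\sum_{i=0}^k\alpha_i$ and $\tau_k=\frac{\alpha_{k+1}}{C_{k+1}}$. Start with $\lambda_0=0$. At iteration $k=0,1,2,\dots$ compute $$\eta_k=\arg\min_{\lambda\in\Lambda}\left\{\varphi(\lambda_k)+\langle\nabla\varphi(\lambda_k),\lambda-\lambda_k\rangle+\frac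 L2\|\lambda-\lambda_k\|_2^2\right\},$$ $$\zeta_k=\arg\min_{\lambda\in\Lambda}\left\{\sum_{i=0}^k\alpha_i\left(\varphi(\lambda_i)+\langle\nabla\varphi(\lambda_i),\lambda-\lambda_i\rangle\right)+\frac L2\|\lambda\|_2^2\right\},$$ $$\lambda_{k+1}=\tau_k\zeta_k+(1-\tau_k)\eta_k,\qquad \hat x_k=\frac1{C_k}\sum_{i=0}^k\alpha_i\,x(\lambda_i).$$ Given accuracies $\tilde\varepsilon_f,\tilde\varepsilon_{eq},\tilde\varepsilon_{in}>0$, the algorithm stops at the first $k$ for which $|f(\hat x_k)+\varphi(\eta_k)|\le\tilde\varepsilon_f$, $\|A_1\hat x_k-b_1\|_2\le\tilde\varepsilon_{eq}$ and $\|(A_2\hat x_k-b_2)_+\|_2\le\tilde\varepsilon_{in}$, and outputs $\hat x_k$. The sequences themselves are defined for all $k\ge0$ by the recursion, irrespective of the stopping test. *)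

(* Defs.v *)
From HB Require Import structures.
From mathcomp Require Import all_boot all_order all_algebra.
From mathcomp Require Import all_classical all_reals all_analysis.

Set Implicit Arguments.
Unset Strict Implicit.
Unset Printing Implicit Defensive.

Import Order.TTheory GRing.Theory Num.Theory.
Import numFieldNormedType.Exports.

Local Open Scope classical_set_scope.
Local Open Scope ring_scope.

#[short(type="normedVectType")]
HB.structure Definition NormedVector (R : realType) :=
  {E of NormedModule R E & Vector R E}.

HB.instance Definition _ (R : realType) (m n : nat) :=
  NormedModule.on 'M[R]_(m, n).

Section Optimization.
Context {T : Type} {R : realType}.

Definition is_argmin (S : set T) (F : T -> R) (x : T) : Prop :=
  S x /\ forall y, S y -> F x <= F y.

Definition is_argmax (S : set T) (F : T -> R) (x : T) : Prop :=
  S x /\ forall y, S y -> F y <= F x.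

End Optimization.

(* The coordinate space H = R^m is 'cV[R]_m and its dual H^* is 'rV[R]_m. *)
Section Euclidean.
Context {R : realType}.

Definition pairing m (u : 'rV[R]_m) (y : 'cV[R]_m) : R := (u *m y) 0 0.

(* Used on rows and columns only; the library norm `|v| on matrices is the
   sup norm. *)
Definition norm2 m n (v : 'M[R]_(m, n)) : R :=
  Num.sqrt (\sum_i \sum_j v i j ^+ 2).

Definition lev m n (v w : 'M[R]_(m, n)) : Prop := forall i j, v i j <= w i j.

Definition pospart m n (v : 'M[R]_(m, n)) : 'M[R]_(m, n) :=
  map_mx (fun t => Num.max t 0) v.

End Euclidean.

Section Operators.
Context {R : realType} {E : normedVectType R} {m : nat}.
Variable A : {linear E -> 'cV[R]_m}.

(* The supremum is attained unless the set is empty (E or H trivial), in which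
   case A = 0 and sup set0 = 0. *)
Definition opnorm : R :=
  sup [set r | exists (x : E) (u : 'rV[R]_m),
    [/\ `|x| = 1, norm2 u = 1 & r = pairing u (A x)]].

Definition adjoint (u : 'rV[R]_m) (x : E) : R^o := pairing u (A x).

Fact adjoint_is_linear u : linear (adjoint u).
Proof.
by move=> a x y; rewrite /adjoint /pairing linearP mulmxDr -scalemxAr !mxE.
Qed.

HB.instance Definition _ u :=
  GRing.isLinear.Build R E R^o _ (adjoint u) (adjoint_is_linear u).

End Operators.

Section StrongConvexity.
Context {R : realType} {E : normedVectType R}.
Variables (Q : set E) (f : E -> R).

(* f is a function on Q: its values outside Q play no role. *)
Definition subgradient (x : E) (g : {linear E -> R^o}) : Prop :=
  Q x /\ forall y, Q y -> f x + g (y - x) <= f y.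

Definition strongly_convex (nu : R) : Prop :=
  forall (x y : E) (g : {linear E -> R^o}), Q x -> Q y -> subgradient x g ->
    f x + g (y - x) + nu / 2 * `|x - y| ^+ 2 <= f y.

(* In the subspace topology of Q the points outside Q are isolated, so that this
   is lower semicontinuity relative to Q. *)
Definition lsc_on : Prop :=
  lower_semicontinuous ((fun x => (f x)%:E) : subspace Q -> \bar R).

End StrongConvexity.

Section Problem.
Context {R : realType} {E : normedVectType R} {m1 m2 : nat}.
Variables (Q : set E) (f : E -> R).
Variables (A1 : {linear E -> 'cV[R]_m1}) (A2 : {linear E -> 'cV[R]_m2}).
Variables (b1 : 'cV[R]_m1) (b2 : 'cV[R]_m2).

Local Notation dual := ('rV[R]_m1 * 'rV[R]_m2)%type.

Definition feasible : set E :=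
  [set x | [/\ Q x, A1 x = b1 & lev (A2 x) b2]].

(* Extended-real valued, so that an infeasible problem has value +oo. *)
Definition Opt : \bar R := ereal_inf [set (f x)%:E | x in feasible].

Definition Lambda : set dual := [set lam | lev 0 lam.2].

Definition adj (lam : dual) (x : E) : R :=
  adjoint A1 lam.1 x + adjoint A2 lam.2 x.

Definition inner_obj (lam : dual) (x : E) : R := - f x - adj lam x.

Definition dual_obj (lam : dual) : R :=
  - pairing lam.1 b1 - pairing lam.2 b2
  + inf [set f x + adj lam x | x in Q].

Definition phi (lam : dual) : R^o :=
  pairing lam.1 b1 + pairing lam.2 b2 + sup [set inner_obj lam x | x in Q].

Definition Lip (nu : R) : R := nu^-1 * (opnorm A1 ^+ 2 + opnorm A2 ^+ 2).

Definition dnorm2sq (lam : dual) : R := norm2 lam.1 ^+ 2 + norm2 lam.2 ^+ 2.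

(* phi mu + <grad phi mu, lam - mu>, the gradient being the Frechet
   differential. *)
Definition phi_lin (mu lam : dual) : R := phi mu + 'd phi mu (lam - mu).

End Problem.

Section Algorithm.
Context {R : realType}.

Definition alpha (i : nat) : R := (i.+1)%:R / 2.
Definition C (k : nat) : R := \sum_(i < k.+1) alpha i.
Definition tau (k : nat) : R := alpha k.+1 / C k.+1.

Context {E : normedVectType R} {m1 m2 : nat}.
Variables (Q : set E) (f : E -> R).
Variables (A1 : {linear E -> 'cV[R]_m1}) (A2 : {linear E -> 'cV[R]_m2}).
Variables (b1 : 'cV[R]_m1) (b2 : 'cV[R]_m2) (nu : R).

Local Notation dual := ('rV[R]_m1 * 'rV[R]_m2)%type.
Local Notation phi_lin := (phi_lin Q f A1 A2 b1 b2).
Local Notation L := (Lip A1 A2 nu).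

Definition fpdgm (lam eta zeta : nat -> dual) : Prop :=
  lam 0 = 0 /\
  forall k : nat,
    [/\ is_argmin (@Lambda R m1 m2)
          (fun l => phi_lin (lam k) l + L / 2 * dnorm2sq (l - lam k)) (eta k),
        is_argmin (@Lambda R m1 m2)
          (fun l => \sum_(i < k.+1) alpha i * phi_lin (lam i) l
                    + L / 2 * dnorm2sq l) (zeta k)
      & lam k.+1 = tau k *: zeta k + (1 - tau k) *: eta k].

Definition xhat (xs : dual -> E) (lam : nat -> dual) (k : nat) : E :=
  (C k)^-1 *: \sum_(i < k.+1) alpha i *: xs (lam i).

Definition stop_crit (xs : dual -> E) (lam eta : nat -> dual)
    (ef eeq ein : R) (k : nat) : Prop :=
  let x := xhat xs lam k in
  [/\ `|f x + phi Q f A1 A2 b1 b2 (eta k)| <= ef,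
      norm2 (A1 x - b1) <= eeq
    & norm2 (pospart (A2 x - b2)) <= ein].

Definition stops_at (xs : dual -> E) (lam eta : nat -> dual)
    (ef eeq ein : R) (k : nat) : Prop :=
  stop_crit xs lam eta ef eeq ein k /\
  forall j, (j < k)%N -> ~ stop_crit xs lam eta ef eeq ein j.

End Algorithm.

(* For positive arguments each ceiling is at least 1, so that the integer under
   absz is nonnegative. *)
Definition iter_bound {R : realType} (c L R1 R2 ef eeq ein : R) : nat :=
  absz (Num.max (Num.ceil (Num.sqrt (c * L * (R1 ^+ 2 + R2 ^+ 2) / ef)))
       (Num.max (Num.ceil (Num.sqrt (8 * L * (R1 ^+ 2 + R2 ^+ 2) / (R1 * eeq))))
                (Num.ceil (Num.sqrt (8 * L * (R1 ^+ 2 + R2 ^+ 2) / (R2 * ein)))))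
        - 1 : int).

(* Main.v *)
Require Import Defs.
From HB Require Import structures.
From mathcomp Require Import all_boot all_order all_algebra.
From mathcomp Require Import all_classical all_reals all_analysis.
From mathcomp Require Import ring lra.

Set Implicit Arguments.
Unset Strict Implicit.
Unset Printing Implicit Defensive.

Import Order.TTheory GRing.Theory Num.Theory.
Import numFieldNormedType.Exports.

Local Open Scope classical_set_scope.
Local Open Scope ring_scope.

(* Since x(lam) maximizes -f - <A^T lam, .>, the functional -A^T lam is a
   subgradient of f at x(lam). Strong convexity there and Young's inequality give,
   for lam in Lambda and any h,
     <h, grad> <= phi(lam + h) - phi(lam) <= <h, grad> + L/2 |h|^2,
   where grad = b - A x(lam); the upper bound shows that phi is finite near Lambda
   and differentiable also at boundary points of Lambda, such as lam_0 = 0.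
   As alpha_k^2 <= C_k, Nesterov's estimate sequence then yields
     C_k phi(eta_k) <= sum_i alpha_i (phi(lam_i) + <grad_i, lam - lam_i>)
                       + L/2 |lam|^2
   for lam in Lambda, and Jensen's inequality turns this into
     f(xhat_k) + phi(eta_k) <= <lam, b - A xhat_k> + L/(2 C_k) |lam|^2.
   Taking lam aligned with the violation of the constraints, with norms 2 R1 and
   2 R2, and comparing with f(xhat_k) + phi(lstar) >= <lstar, b - A xhat_k> bounds
   both the gap and the violations by 8 L (R1^2 + R2^2) / (k+1)^2. Finally, the
   first-order condition at lstar says that x(lstar) is feasible and complementary
   to lstar, so Opt = - phi(lstar). *)

(** * The Euclidean norm and the duality pairing on coordinate spaces *)

Section EuclideanTheory.
Context {R : realType}.

Section Rectangular.
Context {m n : nat}.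
Implicit Types v w : 'M[R]_(m, n).

Lemma norm2_ge0 v : 0 <= norm2 v.
Proof. exact: sqrtr_ge0. Qed.

Lemma norm2_sqr v : norm2 v ^+ 2 = \sum_i \sum_j v i j ^+ 2.
Proof.
rewrite sqr_sqrtr// sumr_ge0// => i _.
by rewrite sumr_ge0// => j _; exact: sqr_ge0.
Qed.

Lemma norm2_sqrZ c v : norm2 (c *: v) ^+ 2 = c ^+ 2 * norm2 v ^+ 2.
Proof.
rewrite !norm2_sqr mulr_sumr; apply: eq_bigr => i _; rewrite mulr_sumr.
by apply: eq_bigr => j _; rewrite mxE exprMn.
Qed.

Lemma norm2Z c v : norm2 (c *: v) = `|c| * norm2 v.
Proof.
apply/eqP; rewrite -(@eqrXn2 _ 2)// ?mulr_ge0 ?norm2_ge0//.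
by rewrite norm2_sqrZ exprMn real_normK ?num_real.
Qed.

Lemma norm20 : norm2 (0 : 'M[R]_(m, n)) = 0.
Proof. by rewrite -[in LHS](scale0r 0) norm2Z normr0 mul0r. Qed.

Lemma norm2_tr v : norm2 v^T = norm2 v.
Proof.
rewrite /norm2 exchange_big/=; congr Num.sqrt.
by apply: eq_bigr => i _; apply: eq_bigr => j _; rewrite mxE.
Qed.

Lemma norm2_eq0 v : norm2 v = 0 -> v = 0.
Proof.
move=> v0; have := norm2_sqr v; rewrite v0 expr0n/= => /esym/eqP.
rewrite psumr_eq0; last by move=> i _; apply: sumr_ge0 => j _; exact: sqr_ge0.
move=> /allP vi0; apply/matrixP => i j; rewrite mxE.
have := vi0 i (mem_index_enum _); rewrite psumr_eq0; last by move=> k _; exact: sqr_ge0.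
by move=> /allP/(_ j (mem_index_enum _)); rewrite sqrf_eq0 => /eqP.
Qed.

(** The squared norm is strongly convex with equality; the abstract estimate sequence knows the
    squared norm only through this identity and its sign. *)
Lemma norm2_sqr_conv (t : R) v w :
  norm2 (t *: v + (1 - t) *: w) ^+ 2 =
  t * norm2 v ^+ 2 + (1 - t) * norm2 w ^+ 2 - t * (1 - t) * norm2 (v - w) ^+ 2.
Proof.
rewrite !norm2_sqr !mulr_sumr -big_split -sumrB/=; apply: eq_bigr => i _.
rewrite !mulr_sumr -big_split -sumrB/=; apply: eq_bigr => j _.
by rewrite !mxE; ring.
Qed.

Lemma norm2_sqr_le v : norm2 v ^+ 2 <= (m * n)%:R * `|v| ^+ 2.
Proof.
rewrite norm2_sqr; have vij i j : v i j ^+ 2 <= `|v| ^+ 2.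
  rewrite -real_normK ?num_real// lerXn2r ?nnegrE//.
  rewrite [leRHS]mx_normrE; exact: (le_bigmax _ (fun k => `|v k.1 k.2|) (i, j)).
apply: (@le_trans _ _ (\sum_(i < m) \sum_(j < n) `|v| ^+ 2)).
  by apply: ler_sum => i _; apply: ler_sum.
by rewrite !sumr_const !card_ord -mulrnA mulr_natl mulnC.
Qed.

End Rectangular.

Section Pairing.
Context {m : nat}.
Implicit Types (u : 'rV[R]_m) (y : 'cV[R]_m).

Lemma pairingE u y : pairing u y = \sum_i u 0 i * y i 0.
Proof. by rewrite /pairing mxE. Qed.

Lemma pairingDl u v y : pairing (u + v) y = pairing u y + pairing v y.
Proof. by rewrite /pairing mulmxDl mxE. Qed.

Lemma pairingZl a u y : pairing (a *: u) y = a * pairing u y.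
Proof. by rewrite /pairing -scalemxAl mxE. Qed.

Lemma pairingDr u y z : pairing u (y + z) = pairing u y + pairing u z.
Proof. by rewrite /pairing mulmxDr mxE. Qed.

Lemma pairingZr a u y : pairing u (a *: y) = a * pairing u y.
Proof. by rewrite /pairing -scalemxAr mxE. Qed.

Lemma pairingNl u y : pairing (- u) y = - pairing u y.
Proof. by rewrite -scaleN1r pairingZl mulN1r. Qed.

Lemma pairingNr u y : pairing u (- y) = - pairing u y.
Proof. by rewrite -scaleN1r pairingZr mulN1r. Qed.

Lemma pairing0l y : pairing 0 y = 0.
Proof. by rewrite -(scale0r 0) pairingZl mul0r. Qed.

Lemma pairing0r u : pairing u 0 = 0.
Proof. by rewrite -(scale0r 0) pairingZr mul0r. Qed.

Lemma pairing_trl y : pairing y^T y = norm2 y ^+ 2.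
Proof.
by rewrite pairingE norm2_sqr; apply: eq_bigr => i _; rewrite big_ord1 mxE expr2.
Qed.

Lemma norm2_sqrD u v :
  norm2 (u + v) ^+ 2 = norm2 u ^+ 2 + pairing u v^T *+ 2 + norm2 v ^+ 2.
Proof.
rewrite !norm2_sqr pairingE !big_ord1 -sumrMnl -!big_split/=.
by apply: eq_bigr => i _; rewrite !mxE sqrrD.
Qed.

Lemma cauchy_schwarz_pairing u y : pairing u y <= norm2 u * norm2 y.
Proof.
have [/norm2_eq0 ->|y0] := eqVneq (norm2 y) 0.
  by rewrite pairing0r mulr_ge0 ?norm2_ge0.
have y_gt0 : 0 < norm2 y by rewrite lt_neqAle eq_sym y0 norm2_ge0.
set a := norm2 u; set b := norm2 y; set p := pairing u y.
(* This vector is [b ^+ 2] times the component of [u] orthogonal to [y^T]. *)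
have : 0 <= norm2 (b ^+ 2 *: u - p *: y^T) ^+ 2 by exact: sqr_ge0.
have -> : norm2 (b ^+ 2 *: u - p *: y^T) ^+ 2 = b ^+ 2 * ((a * b) ^+ 2 - p ^+ 2).
  rewrite -scaleNr norm2_sqrD linearZ/= trmxK pairingZl pairingZr !norm2_sqrZ norm2_tr.
  by rewrite -/a -/b -/p; ring.
rewrite pmulr_rge0 ?exprn_gt0// subr_ge0 => pab.
rewrite (le_trans (ler_norm _))// -(@ler_pXn2r _ 2)// ?nnegrE ?mulr_ge0 ?norm2_ge0//.
by rewrite real_normK ?num_real.
Qed.

Lemma lev_pairing_ge0 u y : lev 0 u -> lev 0 y -> 0 <= pairing u y.
Proof.
move=> u0 y0; rewrite pairingE sumr_ge0// => i _.
by rewrite mulr_ge0//; [have := u0 0 i | have := y0 i 0]; rewrite mxE.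
Qed.

Lemma pairing_pospart_tr y : pairing (pospart y)^T y = norm2 (pospart y) ^+ 2.
Proof.
rewrite pairingE norm2_sqr; apply: eq_bigr => i _; rewrite big_ord1 !mxE.
by case: leP => y0; rewrite ?mul0r ?expr0n ?expr2.
Qed.

(** Against a nonnegative [u], passing from [y] to its positive part can only increase the pairing;
    Cauchy-Schwarz does the rest. *)
Lemma pairing_le_pospart u y :
  lev 0 u -> pairing u y <= norm2 u * norm2 (pospart y).
Proof.
move=> u0; apply: le_trans (cauchy_schwarz_pairing _ _).
rewrite !pairingE ler_sum// => i _; rewrite mxE ler_wpM2l//.
  by have := u0 0 i; rewrite mxE.
by rewrite le_max lexx.
Qed.

End Pairing.

End EuclideanTheory.

(** * The weights of the method and Nesterov's estimate sequence *)

Section EstimateSequence.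
Context {R : realType}.

Lemma sum_alpha k : C k = (k.+1)%:R * (k.+2)%:R / 4 :> R.
Proof.
rewrite /C; elim: k => [|k IH]; first by rewrite big_ord1 /alpha /=; field.
by rewrite big_ord_recr/= IH /alpha; field.
Qed.

Lemma alpha_gt0 k : 0 < alpha k :> R.
Proof. by rewrite divr_gt0. Qed.

Lemma C_gt0 k : 0 < C k :> R.
Proof. by rewrite sum_alpha divr_gt0// mulr_gt0. Qed.

Lemma CS k : C k.+1 = C k + alpha k.+1 :> R.
Proof. by rewrite /C big_ord_recr. Qed.

(** At index [k.+1] this says [C k.+1 * tau k ^+ 2 <= 1], the condition on the weights that drives
    the induction in [psi_eta]. *)
Lemma alpha_sqr_le k : alpha k ^+ 2 <= C k :> R.
Proof.
rewrite sum_alpha /alpha -subr_ge0.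
rewrite (_ : _ - _ = k.+1%:R / 4); first by rewrite divr_ge0.
by field.
Qed.

Lemma tau_gt0 k : 0 < tau k :> R.
Proof. by rewrite divr_gt0 ?alpha_gt0 ?C_gt0. Qed.

Lemma onem_tau k : 1 - tau k = C k / C k.+1 :> R.
Proof. by rewrite /tau CS; field; rewrite -CS gt_eqF ?C_gt0. Qed.

Lemma tau_le1 k : tau k <= 1 :> R.
Proof. by rewrite -subr_ge0 onem_tau divr_ge0 ?ltW ?C_gt0. Qed.

Context {V : lmodType R}.
Variable S : set V.

(* The minimum of a [2 c]-strongly convex [F], with [G = c |y - x|^2]. *)
Lemma argmin_strong (F : V -> R) (G : R) (x y : V) :
  0 <= G ->
  (forall t, 0 < t -> t <= 1 -> S (t *: y + (1 - t) *: x)) ->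
  (forall t, 0 < t -> t <= 1 ->
    F (t *: y + (1 - t) *: x) <= t * F y + (1 - t) * F x - t * (1 - t) * G) ->
  is_argmin S F x -> F x + G <= F y.
Proof.
move=> G0 Sxy Fconv [_ Fx]; rewrite leNgt; apply/negP => FG.
(* Minimality of [x] is compared with the point at parameter [t] of the segment, and the inequality
   is divided by [t]. *)
have h t (t0 : 0 < t) (t1 : t <= 1) : F x + (1 - t) * G <= F y.
  have := le_trans (Fx _ (Sxy t t0 t1)) (Fconv t t0 t1).
  by rewrite -(ler_pM2l t0 _ (F y)); lra.
have := h _ ltr01 (lexx _); rewrite subrr mul0r addr0 => Fxy.
have G_gt0 : 0 < G by lra.
(* With this [t], [F x + (1 - t) * G] still exceeds [F y] by half of the assumed excess, against
   [h]. *)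
pose t := (F x + G - F y) / (2 * G).
have t0 : 0 < t by rewrite divr_gt0 ?mulr_gt0//; lra.
have t1 : t <= 1 by rewrite ler_pdivrMr ?mulr_gt0//; lra.
have := h t t0 t1; rewrite mulrBl mul1r.
have -> : t * G = (F x + G - F y) / 2 by rewrite /t; field; rewrite gt_eqF.
lra.
Qed.

(** * The scheme in the abstract: [q] is a squared norm, [l z] the linearization of [phi] at [z],
    and [M] half the Lipschitz constant *)

Variables (q phi : V -> R) (l : V -> V -> R) (M : R).
Hypothesis M_ge0 : 0 <= M.
Hypothesis q_ge0 : forall x, 0 <= q x.
Hypothesis q_conv : forall (t : R) x y,
  q (t *: x + (1 - t) *: y) = t * q x + (1 - t) * q y - t * (1 - t) * q (x - y).
Hypothesis S_conv : forall (t : R) x y,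
  0 <= t -> t <= 1 -> S x -> S y -> S (t *: x + (1 - t) *: y).
Hypothesis l_affine : forall z (t : R) x y,
  l z (t *: x + (1 - t) *: y) = t * l z x + (1 - t) * l z y.
Hypothesis l_le : forall x y, S x -> S y -> l x y <= phi y.
Hypothesis phi_le : forall x y, S x -> S y -> phi y <= l x y + M * q (y - x).
Variables lam eta zeta : nat -> V.
Hypothesis S0 : S 0.
Hypothesis lam0 : lam 0 = 0.
Hypothesis etaP : forall k,
  is_argmin S (fun x => l (lam k) x + M * q (x - lam k)) (eta k).
Hypothesis zetaP : forall k,
  is_argmin S (fun x => \sum_(i < k.+1) alpha i * l (lam i) x + M * q x) (zeta k).
Hypothesis lamS : forall k,
  lam k.+1 = tau k *: zeta k + (1 - tau k) *: eta k.

Lemma iterates_in k : S (lam k).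
Proof.
case: k => [|k]; first by rewrite lam0.
rewrite lamS; apply: S_conv.
- exact/ltW/tau_gt0.
- exact: tau_le1.
- by case: (zetaP k).
- by case: (etaP k).
Qed.

Let psi k x := \sum_(i < k.+1) alpha i * l (lam i) x + M * q x.

(** The linearizations are affine, so [psi k] inherits the strong convexity of [M * q], and
    [argmin_strong] applies to its minimizer [zeta k]. *)
Let psi_zeta k x : S x -> psi k (zeta k) + M * q (x - zeta k) <= psi k x.
Proof.
move=> Sx; apply: argmin_strong (zetaP k).
- by rewrite mulr_ge0.
- by move=> t t0 t1; apply: S_conv => //; [exact: ltW | case: (zetaP k)].
- move=> t _ _; rewrite q_conv.
  under eq_bigr => i _ do rewrite l_affine.
  rewrite (_ : \sum_i _ = t * (\sum_(i < k.+1) alpha i * l (lam i) x) +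
    (1 - t) * \sum_(i < k.+1) alpha i * l (lam i) (zeta k)); last first.
    by rewrite !mulr_sumr -big_split/=; apply: eq_bigr => i _; ring.
  by rewrite /psi; lra.
Qed.

Let qZ t x : q (t *: x) = t ^+ 2 * q x.
Proof.
have q0 : q 0 = 0.
  (* At [t = 2] and both points 0 the identity reads [q 0 = 3 * q 0]. *)
  by have := q_conv 2 0 0; rewrite !scaler0 subr0 addr0; lra.
by have := q_conv t x 0; rewrite scaler0 addr0 subr0 q0 => ->; ring.
Qed.

Let psi_eta k x : S x -> C k * phi (eta k) <= psi k x.
Proof.
elim: k x => [|k IH] x Sx.
  (* Since [alpha 0 = C 0 = 1/2], the base case is half of the minimality of [eta 0], with the other
     half of [M * q x] to spare. *)
  have [Se /(_ x Sx)/= le_eta] := etaP 0; have := phi_le S0 Se.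
  rewrite /psi /C !big_ord1 /alpha /=; move: le_eta; rewrite lam0 !subr0.
  by have := mulr_ge0 M_ge0 (q_ge0 x); lra.
have Sz : S (zeta k) by case: (zetaP k).
have Se : S (eta k) by case: (etaP k).
have [Se1 eta1] := etaP k.+1.
set t : R := tau k; have tk : t * C k.+1 = alpha k.+1.
  by rewrite /t /tau divfK// gt_eqF ?C_gt0.
have t0 : 0 <= t by exact/ltW/tau_gt0.
(* A competitor for [eta k.+1]: it mixes [x] and [eta k] with the weights by which [lam k.+1] mixes
   [zeta k] and [eta k], so the [eta k] terms cancel in [w - lam k.+1]. *)
pose w := t *: x + (1 - t) *: eta k.
have Sw : S w by apply: S_conv => //; exact: tau_le1.
have wE : w - lam k.+1 = t *: (x - zeta k).
  by rewrite lamS scalerBr opprD addrACA subrr addr0.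
have := eta1 _ Sw; rewrite /= wE qZ l_affine => w_le.
have Ct : C k.+1 * t ^+ 2 <= 1.
  have C0 : 0 < C k.+1 :> R := C_gt0 k.+1.
  rewrite -(ler_pM2l C0) mulr1 mulrA -expr2 -exprMn [C _ * t]mulrC tk.
  exact: alpha_sqr_le.
have CE : C k.+1 * (1 - t) = C k.
  by rewrite onem_tau mulrC divfK// gt_eqF ?C_gt0.
have -> : psi k.+1 x = psi k x + alpha k.+1 * l (lam k.+1) x.
  by rewrite /psi big_ord_recr/= addrAC.
(* Lower bound for [psi k x]: [psi_zeta], then the induction hypothesis at [zeta k], then the
   linearization at [lam k.+1] lying below [phi] at [eta k]. *)
apply: (@le_trans _ _ (C k * l (lam k.+1) (eta k) + M * q (x - zeta k)
    + alpha k.+1 * l (lam k.+1) x)); last first.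
  rewrite lerD2r (le_trans _ (psi_zeta k Sx))// lerD2r (le_trans _ (IH _ Sz))//.
  by rewrite ler_pM2l ?C_gt0// l_le//; exact: iterates_in.
apply: (@le_trans _ _ (C k.+1 * (l (lam k.+1) (eta k.+1) +
    M * q (eta k.+1 - lam k.+1)))).
  by rewrite ler_pM2l ?C_gt0// phi_le//; exact: iterates_in.
apply: (@le_trans _ _ (C k.+1 * (t * l (lam k.+1) x +
    (1 - t) * l (lam k.+1) (eta k) + M * (t ^+ 2 * q (x - zeta k))))).
  by rewrite ler_pM2l ?C_gt0.
have Mq : 0 <= M * q (x - zeta k) by exact: mulr_ge0.
have := ler_wpM2r Mq Ct; rewrite -tk -CE; lra.
Qed.

Lemma estimate_sequence k x : S x ->
  C k * phi (eta k) <= \sum_(i < k.+1) alpha i * l (lam i) x + M * q x.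
Proof. exact: psi_eta. Qed.

End EstimateSequence.

(** * Boundedness of linear maps and the operator norm inequality *)

Section FiniteDimension.
Context {R : realType}.

Lemma linear_rV_bounded n (W : normedModType R) (g : {linear 'rV[R]_n -> W}) :
  exists2 K, 0 < K & forall v, `|g v| <= K * `|v|.
Proof.
exists (1 + \sum_j `|g (delta_mx 0 j)|).
  by rewrite ltr_pwDl// sumr_ge0.
move=> v; rewrite {1}[v]row_sum_delta linear_sum mulrDl mul1r ler_wpDl//.
rewrite mulr_suml (le_trans (ler_norm_sum _ _ _))// ler_sum// => j _.
rewrite linearZ normrZ mulrC ler_wpM2l//.
by rewrite [leRHS]mx_normrE; exact: (le_bigmax _ (fun k => `|v k.1 k.2|) (ord0, j)).
Qed.

Lemma linear_rV_continuous n (W : normedModType R) (g : {linear 'rV[R]_n -> W}) :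
  continuous g.
Proof.
have [K _ gK] := linear_rV_bounded g.
apply/bounded_linear_continuous/linear_boundedP; near=> r => v.
rewrite (le_trans (gK v))// ler_wpM2r//; near: r.
Unshelve. all: by end_near. Qed.

Context {E : normedVectType R}.

Import VectorInternalTheory.

(** Equivalence of norms: on the compact unit sphere of the coordinate space the norm of [E] attains
    a positive minimum, whose inverse is the constant. *)
Lemma coordinates_bounded : exists2 K, 0 < K & forall x : E, `|v2r x| <= K * `|x|.
Proof.
have [K K0 gK] := linear_rV_bounded (r2v : {linear _ -> E}).
pose S := [set v : 'rV[R]_(dim E) | `|v| = 1].
have [[v0 Sv0]|S0] := pselect (S !=set0); last first.
  exists 1 => // x; have [->|x0] := eqVneq (v2r x) 0; first by rewrite normr0 mul1r.
  exfalso; apply: S0; exists (`|v2r x|^-1 *: v2r x).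
  by rewrite /S/= normrZ normfV normr_id mulVf// normr_eq0.
have Scompact : compact S.
  apply: bounded_closed_compact.
    by exists 1; split => // M M1 v /= ->; exact: ltW.
  apply: (@preimage_closed _ R^o (fun v => `|v|) [set 1%R]); last exact: closed_eq.
  by move=> v _; exact: norm_continuous.
have normc : {within S, continuous (fun v : 'rV[R]_(dim E) => `|r2v v : E|)}.
  apply: continuous_subspaceT => v.
  apply: (@continuous_comp _ _ _ (r2v : _ -> E) Num.norm); last exact: norm_continuous.
  exact: linear_rV_continuous.
have [v /= Sv vmin] := EVT_min_rV (ex_intro _ v0 Sv0) Scompact normc.
have v_gt0 : 0 < `|r2v v : E|.
  rewrite normr_gt0; apply/eqP => v0'; move: Sv.
  by rewrite inE /S/= -(r2vK v) v0' linear0 normr0 => /eqP; rewrite eq_sym oner_eq0.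
exists (`|r2v v : E|^-1); first by rewrite invr_gt0.
move=> x; rewrite mulrC ler_pdivlMr//.
have [->|x0] := eqVneq (v2r x) 0; first by rewrite normr0 mul0r.
have nx0 : 0 < `|v2r x| by rewrite normr_gt0.
rewrite mulrC -ler_pdivlMr//.
have : `|v2r x|^-1 *: v2r x \in S.
  by rewrite inE /S/= normrZ normfV normr_id mulVf// gt_eqF.
by move=> /vmin; rewrite linearZ/= v2rK normrZ normfV normr_id mulrC.
Qed.

Lemma linear_bounded m (A : {linear E -> 'cV[R]_m}) :
  exists2 K, 0 < K & forall x, `|A x| <= K * `|x|.
Proof.
have [K1 K1_gt0 hK1] := coordinates_bounded.
have [K2 K2_gt0 hK2] := linear_rV_bounded (A \o (r2v : {linear _ -> E}))%FUN.
exists (K2 * K1); first exact: mulr_gt0.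
move=> x; rewrite -{1}(v2rK x) (le_trans (hK2 _))// -mulrA ler_wpM2l//.
exact: ltW.
Qed.

Lemma pairing_opnorm m (A : {linear E -> 'cV[R]_m}) u x :
  pairing u (A x) <= opnorm A * norm2 u * `|x|.
Proof.
have [->|x0] := eqVneq x 0; first by rewrite linear0 pairing0r normr0 mulr0.
have [/norm2_eq0 ->|u0] := eqVneq (norm2 u) 0.
  by rewrite pairing0l norm20 mulr0 mul0r.
have u_gt0 : 0 < norm2 u by rewrite lt_neqAle eq_sym u0 norm2_ge0.
have x_gt0 : 0 < `|x| by rewrite normr_gt0.
rewrite -mulrA -ler_pdivrMr ?mulr_gt0//; apply: ub_le_sup; last first.
  exists (`|x|^-1 *: x), ((norm2 u)^-1 *: u); split.
  - by rewrite normrZ normfV normr_id mulVf// normr_eq0.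
  - by rewrite norm2Z normfV ger0_norm ?norm2_ge0// mulVf.
  - by rewrite linearZ/= pairingZl pairingZr invfM mulrC mulrA.
(* The supremum dominates its elements only once the set is known to be bounded above; the bound
   used comes from [r <= 1 + r ^+ 2]. *)
have [K K_gt0 hK] := linear_bounded A.
exists (1 + (m * 1)%:R * K ^+ 2) => _ [y [v [y1 v1 ->]]].
rewrite (le_trans (cauchy_schwarz_pairing _ _))// v1 mul1r.
apply: (@le_trans _ _ (1 + norm2 (A y) ^+ 2)).
  by have := sqr_ge0 (norm2 (A y) - 2^-1); lra.
rewrite lerD2l (le_trans (norm2_sqr_le _))// ler_wpM2l// lerXn2r ?nnegrE//.
  exact: ltW.
by have := hK y; rewrite y1 mulr1.
Qed.

End FiniteDimension.

(** * Quadratic bound on the adjoint *)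

Section Young.
Context {R : realType} {E : normedVectType R} {m1 m2 : nat}.
Variables (A1 : {linear E -> 'cV[R]_m1}) (A2 : {linear E -> 'cV[R]_m2}).

(* Young's inequality [s r <= s^2 / (2 nu) + nu r^2 / 2], applied to the operator
   norm bound [s] of [adj A1 A2 h]. *)
Lemma adj_le_young nu h x : 0 < nu ->
  adj A1 A2 h x <= Lip A1 A2 nu / 2 * dnorm2sq h + nu / 2 * `|x| ^+ 2.
Proof.
move=> nu0; set s := opnorm A1 * norm2 h.1 + opnorm A2 * norm2 h.2.
apply: (@le_trans _ _ (s * `|x|)).
  by rewrite mulrDl lerD// pairing_opnorm.
apply: (@le_trans _ _ (nu^-1 / 2 * s ^+ 2 + nu / 2 * `|x| ^+ 2)).
  rewrite -subr_ge0 (_ : _ - _ = nu / 2 * (`|x| - nu^-1 * s) ^+ 2).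
    by rewrite mulr_ge0 ?sqr_ge0// divr_ge0// ltW.
  by field; rewrite gt_eqF.
rewrite lerD2r /Lip /dnorm2sq [nu^-1 * _ / 2]mulrAC -[leRHS]mulrA.
rewrite ler_pM2l ?divr_gt0 ?invr_gt0//.
(* This square is the defect in the two-term Cauchy-Schwarz inequality for [s]. *)
have := sqr_ge0 (opnorm A1 * norm2 h.2 - opnorm A2 * norm2 h.1).
by rewrite /s; lra.
Qed.

End Young.

(** Induction on [k] with two-point convexity: the new average is the mixture of [y k.+1] and the
    old average with weights [tau k] and [1 - tau k]. *)
Lemma weighted_jensen (R : realType) (E : lmodType R) (Q : set E) (f : E -> R)
    (y : nat -> E) k :
  convex_set Q -> convex_function Q f -> (forall i, Q (y i)) ->
  let x := (C k)^-1 *: \sum_(i < k.+1) alpha i *: y i in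
  Q x /\ C k * f x <= \sum_(i < k.+1) alpha i * f (y i).
Proof.
move=> Qconv fconv Qy; elim: k => [|k /= [Qx fx]].
  rewrite /C !big_ord1 scalerA mulVf ?scale1r; first by split.
  by rewrite gt_eqF ?alpha_gt0.
set x := _ *: _ in Qx fx *.
have C0 : 0 < C k.+1 :> R := C_gt0 k.+1.
have -> : (C k.+1)^-1 *: \sum_(i < k.+2) alpha i *: y i =
    tau k *: y k.+1 + (1 - tau k) *: x.
  rewrite big_ord_recr/= scalerDr scalerA addrC; congr (_ + _).
    by rewrite mulrC.
  by rewrite /x scalerA onem_tau mulrAC divff ?mul1r// gt_eqF ?C_gt0.
pose t : {i01 R} := Itv01 (ltW (tau_gt0 k)) (tau_le1 k).
split.
  by apply/set_mem/(Qconv (y k.+1) x t); rewrite inE.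
set z := _ + _; have fz : f z <= tau k * f (y k.+1) + (1 - tau k) * f x.
  by apply: (fconv t (y k.+1) x); rewrite inE.
rewrite big_ord_recr/=.
apply: (@le_trans _ _ (C k * f x + alpha k.+1 * f (y k.+1))); last by rewrite lerD2r.
move: fz; rewrite -(ler_pM2l C0) => /le_trans; apply.
by rewrite onem_tau le_eqVlt; apply/orP; left; apply/eqP; rewrite /tau; field; rewrite gt_eqF.
Qed.

(** * Smoothness of the dual function and strong duality *)

Section DualFunction.
Context {R : realType} {E : normedVectType R} {m1 m2 : nat}.
Variables (Q : set E) (f : E -> R) (nu : R).
Variables (A1 : {linear E -> 'cV[R]_m1}) (A2 : {linear E -> 'cV[R]_m2}).
Variables (b1 : 'cV[R]_m1) (b2 : 'cV[R]_m2).

Local Notation dual := ('rV[R]_m1 * 'rV[R]_m2)%type.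
Local Notation phi := (phi Q f A1 A2 b1 b2).
Local Notation L := (Lip A1 A2 nu).
Implicit Types (lam mu : dual) (x y : E).

Lemma Lambda0 : Lambda (0 : dual).
Proof. by move=> i j; rewrite mxE. Qed.

Lemma Lambda_conv t lam mu : 0 <= t -> t <= 1 -> Lambda lam -> Lambda mu ->
  Lambda (t *: lam + (1 - t) *: mu).
Proof.
move=> t0 t1 lamL muL i j; rewrite !mxE.
rewrite addr_ge0// mulr_ge0 ?subr_ge0//; [have := lamL i j | have := muL i j];
  by rewrite mxE.
Qed.

Lemma dnorm2sq_ge0 lam : 0 <= dnorm2sq lam.
Proof. by rewrite addr_ge0 ?sqr_ge0. Qed.

Lemma dnorm2sq_conv t lam mu : dnorm2sq (t *: lam + (1 - t) *: mu) =
  t * dnorm2sq lam + (1 - t) * dnorm2sq mu - t * (1 - t) * dnorm2sq (lam - mu).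
Proof. by rewrite /dnorm2sq !norm2_sqr_conv; ring. Qed.

Lemma dnorm2sqZ t lam : dnorm2sq (t *: lam) = t ^+ 2 * dnorm2sq lam.
Proof. by rewrite /dnorm2sq !norm2_sqrZ mulrDr. Qed.

Lemma dnorm2sq_le lam : dnorm2sq lam <= (m1 + m2)%:R * `|lam| ^+ 2.
Proof.
rewrite natrD mulrDl lerD// (le_trans (norm2_sqr_le _))// mul1n ler_wpM2l//.
  by rewrite lerXn2r ?nnegrE// prod_normE le_max lexx.
by rewrite lerXn2r ?nnegrE// prod_normE le_max lexx orbT.
Qed.

(** The Lagrangian at [x] is [f x - slack x lam], and [slack (xs lam)] turns out to be the
    differential of [phi] at [lam]; hence the codomain [R^o]. *)
Definition slack x lam : R^o :=
  pairing lam.1 (b1 - A1 x) + pairing lam.2 (b2 - A2 x).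

Fact slack_is_linear x : linear (slack x).
Proof.
by move=> a u v; rewrite /slack/= !pairingDl !pairingZl scalerDr addrACA.
Qed.

HB.instance Definition _ x :=
  GRing.isLinear.Build R dual R^o _ (slack x) (slack_is_linear x).

Lemma slack_continuous x : continuous (slack x).
Proof.
have pairing_linear m (y : 'cV[R]_m) : linear (fun u => pairing u y : R^o).
  by move=> a u v; rewrite pairingDl pairingZl.
have pairing_cont m (y : 'cV[R]_m) : continuous (fun u => pairing u y : R^o).
  pose g := HB.pack_for {linear 'rV[R]_m -> R^o} (fun u => pairing u y : R^o)
    (GRing.isLinear.Build R _ R^o _ _ (pairing_linear _ y)).
  exact: (@linear_rV_continuous _ _ _ g).
move=> lam; apply: cvgD.
  apply: (@continuous_comp _ _ _ fst (fun u => pairing u _ : R^o)).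
    exact: cvg_fst.
  exact: pairing_cont.
apply: (@continuous_comp _ _ _ snd (fun u => pairing u _ : R^o)).
  exact: cvg_snd.
exact: pairing_cont.
Qed.

Lemma slackB lam x y : slack y lam = slack x lam + adj A1 A2 lam (x - y).
Proof.
by rewrite /slack /adj /adjoint !linearB/= !pairingDr !pairingNr; ring.
Qed.

Lemma inner_objE lam x :
  pairing lam.1 b1 + pairing lam.2 b2 + inner_obj f A1 A2 lam x = slack x lam - f x.
Proof.
by rewrite /slack /inner_obj /adj /adjoint !pairingDr !pairingNr; ring.
Qed.

Hypothesis nu_gt0 : 0 < nu.
Hypothesis f_strong : strongly_convex Q f nu.
Variable xs : dual -> E.
Hypothesis xs_sol : forall lam, Lambda lam ->
  is_argmax Q (inner_obj f A1 A2 lam) (xs lam).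

(* The optimality of [xs lam] means that minus the adjoint of [lam] is a
   subgradient of [f] at [xs lam], so strong convexity applies there. *)
Lemma inner_obj_growth lam y : Lambda lam -> Q y ->
  inner_obj f A1 A2 lam y + nu / 2 * `|xs lam - y| ^+ 2 <=
  inner_obj f A1 A2 lam (xs lam).
Proof.
move=> lamL Qy; have [Qx xmax] := xs_sol lamL.
pose g : {linear E -> R^o} := adjoint A1 (- lam.1) \+ adjoint A2 (- lam.2).
have gE z : g z = - adj A1 A2 lam z.
  by rewrite /g /= /adjoint !pairingNl opprD.
have adjB u v : adj A1 A2 lam (u - v) = adj A1 A2 lam u - adj A1 A2 lam v.
  by rewrite /adj !linearB/= addrACA opprD.
have sg : subgradient Q f (xs lam) g.
  split=> // z /xmax; rewrite /inner_obj gE adjB; lra.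
have := f_strong Qx Qy sg; rewrite /inner_obj gE adjB; lra.
Qed.

(** Young's inequality for [mu - lam] produces exactly the term [nu / 2 * |xs lam - y|^2] that
    [inner_obj_growth] absorbs. Only [lam] has to lie in [Lambda]. *)
Lemma slack_le_quadratic lam mu y : Lambda lam -> Q y ->
  slack y mu - f y <= slack (xs lam) mu - f (xs lam) + L / 2 * dnorm2sq (mu - lam).
Proof.
move=> lamL Qy; have := inner_obj_growth lamL Qy.
have := adj_le_young A1 A2 (mu - lam) (xs lam - y) nu_gt0.
have := slackB (mu - lam) (xs lam) y; rewrite !linearB/=.
have := inner_objE lam y; have := inner_objE lam (xs lam).
rewrite /slack -/(slack _ _); lra.
Qed.

Lemma phi_ge mu x : Q x -> slack x mu - f x <= phi mu.
Proof.
move=> Qx; rewrite -inner_objE lerD2l; apply: ub_le_sup; last by exists x.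
(* Finiteness of the supremum for arbitrary [mu], from the quadratic bound based at 0. *)
exists (slack (xs 0) mu - f (xs 0) + L / 2 * dnorm2sq (mu - 0)
        - (pairing mu.1 b1 + pairing mu.2 b2)) => _ [y Qy <-].
by rewrite lerBrDl inner_objE slack_le_quadratic//; exact: Lambda0.
Qed.

Lemma phi_le_quadratic lam mu : Lambda lam ->
  phi mu <= slack (xs lam) mu - f (xs lam) + L / 2 * dnorm2sq (mu - lam).
Proof.
move=> lamL; have [Qx _] := xs_sol lamL.
rewrite -lerBrDl; apply: ge_sup.
  by exists (inner_obj f A1 A2 mu (xs lam)), (xs lam).
by move=> _ [y Qy <-]; rewrite lerBrDl inner_objE; exact: slack_le_quadratic.
Qed.

Lemma phi_solE lam : Lambda lam -> phi lam = slack (xs lam) lam - f (xs lam).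
Proof.
move=> lamL; apply/le_anti/andP; split; last by apply: phi_ge; case: (xs_sol lamL).
have := phi_le_quadratic lam lamL.
by rewrite subrr /dnorm2sq !norm20 expr0n/= addr0 mulr0 addr0.
Qed.

Lemma diff_phi lam : Lambda lam -> 'd phi lam = slack (xs lam) :> (dual -> R^o).
Proof.
move=> lamL; apply: diff_unique; first exact: slack_continuous.
apply/eqaddoP => _/posnumP[e].
have L_ge0 : 0 <= L / 2.
  by rewrite divr_ge0// mulr_ge0 ?invr_ge0 ?(ltW nu_gt0)// addr_ge0 ?sqr_ge0.
(* The factor [m1 + m2] compares the Euclidean norm with the sup norm; the added 1 makes [K] safe to
   divide by. *)
set K := L / 2 * (m1 + m2)%:R + 1.
have K_gt0 : 0 < K by rewrite ltr_wpDl// mulr_ge0.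
near=> h; have hK : `|h| <= e%:num / K.
  by near: h; apply: (@nbhs0_le _ dual); rewrite divr_gt0.
have -> : (phi \o shift lam - (cst (phi lam) + slack (xs lam))) h =
    phi (h + lam) - (phi lam + slack (xs lam) h) by [].
have := phi_le_quadratic (h + lam) lamL; rewrite addrK linearD/=.
have := phi_ge (h + lam) (xs_sol lamL).1; rewrite linearD/= (phi_solE lamL).
set D := phi (h + lam) - _; move=> D_ge0 D_le.
rewrite ger0_norm; last by rewrite /D; lra.
apply: (@le_trans _ _ (L / 2 * dnorm2sq h)); first by rewrite /D; lra.
apply: (@le_trans _ _ (L / 2 * ((m1 + m2)%:R * `|h| ^+ 2))).
  by rewrite ler_wpM2l// dnorm2sq_le.
apply: (@le_trans _ _ (K * `|h| * `|h|)).
  by rewrite mulrA expr2 mulrA !ler_wpM2r// lerDl.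
by rewrite ler_wpM2r// mulrC -ler_pdivlMr.
Unshelve. all: by end_near. Qed.

Lemma phi_linE lam mu : Lambda lam ->
  phi_lin Q f A1 A2 b1 b2 lam mu = slack (xs lam) mu - f (xs lam).
Proof.
move=> lamL; rewrite /phi_lin diff_phi// phi_solE// linearB/=.
by rewrite addrC addrA subrK.
Qed.


(** The infimum in [dual_obj] is attained at [xs lam], as is the supremum in [phi]; solutions of the
    dual problem thus become minimizers of [phi]. *)
Lemma dual_objE lam : Lambda lam -> dual_obj Q f A1 A2 b1 b2 lam = - phi lam.
Proof.
move=> lamL; have [Qx xmax] := xs_sol lamL.
have -> : phi lam = pairing lam.1 b1 + pairing lam.2 b2 + inner_obj f A1 A2 lam (xs lam).
  by rewrite phi_solE// inner_objE.
have -> : inner_obj f A1 A2 lam (xs lam) = - inf [set f x + adj A1 A2 lam x | x in Q].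
  have xlb : lbound [set f x + adj A1 A2 lam x | x in Q]
                    (- inner_obj f A1 A2 lam (xs lam)).
    by move=> _ [y /xmax ymax <-]; move: ymax; rewrite /inner_obj; lra.
  apply: oppr_inj; rewrite opprK; apply/le_anti/andP; split.
    by apply: lb_le_inf => //; exists (f (xs lam) + adj A1 A2 lam (xs lam)), (xs lam).
  apply: ge_inf; first by exists (- inner_obj f A1 A2 lam (xs lam)).
  by exists (xs lam) => //; rewrite /inner_obj opprD !opprK.
by rewrite /dual_obj; lra.
Qed.

(** First-order optimality: a step [t *: h] changes [phi] by at most [t * s + t ^+ 2 * K], and
    dividing by [t] leaves [0 <= s + t * K]. *)
Lemma slack_minimizer_ge0 lstar h : is_argmin (@Lambda R m1 m2) phi lstar ->
  Lambda (lstar + h) -> 0 <= slack (xs lstar) h.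
Proof.
move=> [lL lmin] lhL; set s := slack _ h; set K := L / 2 * dnorm2sq h.
have sK t : 0 < t -> t <= 1 -> 0 <= s + t * K.
  move=> t0 t1; have thL : Lambda (lstar + t *: h).
    rewrite (_ : _ + _ = t *: (lstar + h) + (1 - t) *: lstar).
      exact: (Lambda_conv (ltW t0)).
    by rewrite scalerDr scalerBl scale1r [RHS]addrC addrA subrK.
  have := le_trans (lmin _ thL) (phi_le_quadratic (lstar + t *: h) lL).
  rewrite (phi_solE lL) [lstar + _ - _]addrAC subrr add0r dnorm2sqZ.
  rewrite linearD linearZ/= -/s => sK.
  by rewrite -(pmulr_rge0 _ t0) /K; move: sK; rewrite /GRing.scale/=; lra.
rewrite leNgt; apply/negP => s0.
have K_gt0 : 0 < K by have := sK 1 ltr01 (lexx _); lra.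
have sK0 : 0 < K - s by lra.
(* For negative [s] this step length makes [s + t * K] equal to [- s ^+ 2 / (K - s)]. *)
have t0 : 0 < - s / (K - s) by rewrite divr_gt0//; lra.
have t1 : - s / (K - s) <= 1 by rewrite ler_pdivrMr//; lra.
have := sK _ t0 t1; rewrite (_ : _ + _ = - (s ^+ 2 / (K - s))); last first.
  by field; rewrite gt_eqF.
by rewrite oppr_ge0 leNgt divr_gt0// exprn_even_gt0//= lt_eqF.
Qed.

Lemma strong_duality lstar : is_argmin (@Lambda R m1 m2) phi lstar ->
  Opt Q f A1 A2 b1 b2 = (- phi lstar)%:E.
Proof.
move=> lmin; have [lL _] := lmin; have [Qx _] := xs_sol lL.
have sl_ge0 := slack_minimizer_ge0 lmin.
have lev0 i j : 0 <= lstar.2 i j by have := lL i j; rewrite mxE.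
have A1x : A1 (xs lstar) = b1.
  (* The first block of multipliers is free, so it may move against the residual, which forces the
     residual to vanish. *)
  have /sl_ge0 : Lambda (lstar + (- (b1 - A1 (xs lstar))^T, 0)).
    by move=> i j; rewrite /= addr0 mxE.
  rewrite /slack/= pairingNl pairing0l addr0 pairing_trl oppr_ge0 => n0.
  apply/esym/subr0_eq/norm2_eq0/eqP; rewrite -sqrf_eq0 eq_le n0.
  exact: sqr_ge0.
have A2x : lev (A2 (xs lstar)) b2.
  move=> i j; have /sl_ge0 : Lambda (lstar + (0, delta_mx 0 i)).
    by move=> i' j'; rewrite /= !mxE addr_ge0// ler0n.
  by rewrite /slack/= pairing0l add0r /pairing -rowE !mxE (ord1 j) subr_ge0.
have sl_le0 : slack (xs lstar) lstar <= 0.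
  (* The direction back to 0 gives complementarity, hence [f (xs lstar) <= - phi lstar]. *)
  have /sl_ge0 : Lambda (lstar + - lstar) by rewrite subrr; exact: Lambda0.
  by rewrite linearN/= oppr_ge0.
have weak y : feasible Q A1 A2 b1 b2 y -> - phi lstar <= f y.
  move=> [Qy A1y A2y]; have := phi_ge lstar Qy.
  rewrite /slack A1y subrr pairing0r add0r.
  have : 0 <= pairing lstar.2 (b2 - A2 y).
    by apply: lev_pairing_ge0 => // i j; rewrite !mxE subr_ge0.
  lra.
have feas : feasible Q A1 A2 b1 b2 (xs lstar) by [].
apply/le_anti/andP; split.
  apply: ge_ereal_inf; exists (f (xs lstar))%:E; first by exists (xs lstar).
  by rewrite lee_fin phi_solE//; lra.
by apply: le_ereal_inf_tmp => _ [y yfeas <-]; rewrite lee_fin weak.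
Qed.

End DualFunction.

(** * Convergence rate of the primal-dual iterates *)

Section Convergence.
Context {R : realType} {E : normedVectType R} {m1 m2 : nat}.
Variables (Q : set E) (f : E -> R) (nu : R).
Variables (A1 : {linear E -> 'cV[R]_m1}) (A2 : {linear E -> 'cV[R]_m2}).
Variables (b1 : 'cV[R]_m1) (b2 : 'cV[R]_m2).

Local Notation dual := ('rV[R]_m1 * 'rV[R]_m2)%type.
Local Notation phi := (phi Q f A1 A2 b1 b2).
Local Notation L := (Lip A1 A2 nu).
Local Notation slackAb := (slack A1 A2 b1 b2).

Hypotheses (Q_convex : convex_set Q) (f_convex : convex_function Q f).
Hypotheses (nu_gt0 : 0 < nu) (f_strong : strongly_convex Q f nu).
Variable xs : dual -> E.
Hypothesis xs_sol : forall lam, Lambda lam ->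
  is_argmax Q (inner_obj f A1 A2 lam) (xs lam).
Variables lam eta zeta : nat -> dual.
Hypothesis run : fpdgm Q f A1 A2 b1 b2 nu lam eta zeta.

Local Notation xhat := (xhat xs lam).

Let L_ge0 : 0 <= L.
Proof. by rewrite mulr_ge0 ?invr_ge0 ?(ltW nu_gt0)// addr_ge0 ?sqr_ge0. Qed.

Lemma Lambda_lam k : Lambda (lam k).
Proof.
have [lam0 runk] := run.
have zetaP i : is_argmin (@Lambda R m1 m2) (fun l => \sum_(j < i.+1)
    alpha j * phi_lin Q f A1 A2 b1 b2 (lam j) l + L / 2 * dnorm2sq l) (zeta i).
  by case: (runk i).
have etaP i : is_argmin (@Lambda R m1 m2) (fun l =>
    phi_lin Q f A1 A2 b1 b2 (lam i) l + L / 2 * dnorm2sq (l - lam i)) (eta i).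
  by case: (runk i).
apply: (iterates_in (@Lambda_conv R m1 m2) (@Lambda0 R m1 m2) lam0 etaP zetaP).
by move=> i; case: (runk i).
Qed.

Lemma xhatP k : Q (xhat k) /\
  C k * f (xhat k) <= \sum_(i < k.+1) alpha i * f (xs (lam i)).
Proof.
apply: (@weighted_jensen _ _ _ _ (xs \o lam)) => // i.
by case: (xs_sol (Lambda_lam i)).
Qed.

(** The slack is affine in the primal point and the weights sum to [C k], so it commutes with
    averaging. *)
Lemma slack_xhat k mu :
  C k * slackAb (xhat k) mu = \sum_(i < k.+1) alpha i * slackAb (xs (lam i)) mu.
Proof.
have C0 : C k != 0 :> R by rewrite gt_eqF ?C_gt0.
have slack0 y : slackAb y mu = slackAb 0 mu + (- adj A1 A2 mu y).
  by rewrite (slackB _ _ _ _ _ 0) sub0r /adj !linearN opprD.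
under eq_bigr do rewrite slack0 mulrDr mulrN.
rewrite slack0 big_split/= -mulr_suml -/(C k) mulrDr sumrN mulrN; congr (_ - _).
have adjZ a y : a * adj A1 A2 mu y = adj A1 A2 mu (a *: y).
  by rewrite /adj !linearZ/= mulrDr.
rewrite adjZ scalerA mulfV// scale1r {1}/adj !linear_sum -big_split/=.
by apply: eq_bigr => i _; rewrite adjZ.
Qed.

Lemma primal_dual_gap k mu : Lambda mu ->
  f (xhat k) + phi (eta k) <= slackAb (xhat k) mu + L / (2 * C k) * dnorm2sq mu.
Proof.
move=> muL; have [lam0 runk] := run.
have C0 : 0 < C k :> R := C_gt0 k.
have := @estimate_sequence R dual (@Lambda R m1 m2) dnorm2sq phi
  (phi_lin Q f A1 A2 b1 b2) (L / 2) _ (@dnorm2sq_ge0 R m1 m2)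
  (@dnorm2sq_conv R m1 m2) (@Lambda_conv R m1 m2) _ _ _ lam eta zeta
  (@Lambda0 R m1 m2) lam0 _ _ _ k mu muL.
move=> est; rewrite -(ler_pM2l C0) mulrDr.
have {}est : C k * phi (eta k) <=
    \sum_(i < k.+1) alpha i * phi_lin Q f A1 A2 b1 b2 (lam i) mu + L / 2 * dnorm2sq mu.
  apply: est.
  - by rewrite divr_ge0.
  - move=> z t x y; rewrite /phi_lin.
    have -> : t *: x + (1 - t) *: y - z = t *: (x - z) + (1 - t) *: (y - z).
      by rewrite !scalerBr addrACA -opprD -scalerDl (addrC t) subrK scale1r.
    by rewrite linearD !linearZ/= /GRing.scale/=; ring.
  - move=> x y xL yL; rewrite (phi_linE _ _ nu_gt0 f_strong xs_sol)//.
    by apply: (phi_ge _ _ nu_gt0 f_strong xs_sol); case: (xs_sol xL).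
  - move=> x y xL yL; rewrite (phi_linE _ _ nu_gt0 f_strong xs_sol)//.
    exact: phi_le_quadratic.
  - by move=> i; case: (runk i).
  - by move=> i; case: (runk i).
  - by move=> i; case: (runk i).
have := (xhatP k).2; move: est.
under eq_bigr do rewrite (phi_linE _ _ nu_gt0 f_strong xs_sol _ (Lambda_lam _)) mulrBr.
rewrite sumrB -slack_xhat.
have -> : C k * (slackAb (xhat k) mu + L / (2 * C k) * dnorm2sq mu) =
    C k * slackAb (xhat k) mu + L / 2 * dnorm2sq mu by field; rewrite gt_eqF.
lra.
Qed.

Variables (R1 R2 : R) (lstar : dual).
Hypotheses (R1_gt0 : 0 < R1) (R2_gt0 : 0 < R2).
Hypothesis lstar_min : is_argmin (@Lambda R m1 m2) phi lstar.
Hypotheses (lstar1 : norm2 lstar.1 <= R1) (lstar2 : norm2 lstar.2 <= R2).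

(** [L / (2 * C k)] times the bound [4 * (R1 ^+ 2 + R2 ^+ 2)] on the multiplier, with [(k+1)(k+2)]
    relaxed to [(k+1)^2]. *)
Let gap k : R := 8 * L * (R1 ^+ 2 + R2 ^+ 2) / k.+1%:R ^+ 2.
Let infeas1 k := norm2 (A1 (xhat k) - b1).
Let infeas2 k := norm2 (pospart (A2 (xhat k) - b2)).

(** [xhat k] is a candidate in the supremum defining [phi lstar], and the radii bound the pairings
    of [lstar] with the residuals. *)
Let f_xhat_ge k : - (R1 * infeas1 k + R2 * infeas2 k) <= f (xhat k) + phi lstar.
Proof.
have := phi_ge b1 b2 nu_gt0 f_strong xs_sol lstar (xhatP k).1.
have lL := lstar_min.1.
have p1 : pairing lstar.1 (A1 (xhat k) - b1) <= R1 * infeas1 k.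
  by rewrite (le_trans (cauchy_schwarz_pairing _ _))// ler_wpM2r ?norm2_ge0.
have p2 : pairing lstar.2 (A2 (xhat k) - b2) <= R2 * infeas2 k.
  by rewrite (le_trans (pairing_le_pospart _ lL))// ler_wpM2r ?norm2_ge0.
rewrite /slack -(opprB _ b1) -(opprB _ b2) !pairingNr; lra.
Qed.

(* The gap inequality at the multiplier of norms [2 R1] and [2 R2] that is aligned
   with the constraint violations of [xhat k]. *)
Let infeas_le_gap k :
  f (xhat k) + phi (eta k) + 2 * (R1 * infeas1 k + R2 * infeas2 k) <= gap k.
Proof.
set v := A1 (xhat k) - b1; set w := A2 (xhat k) - b2.
pose mu : dual := ((2 * R1 / norm2 v) *: v^T,
  (2 * R2 / norm2 (pospart w)) *: (pospart w)^T).
have muL : Lambda mu.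
  move=> i j; rewrite !mxE mulr_ge0 ?le_max ?lexx ?orbT//.
  by rewrite divr_ge0 ?norm2_ge0// mulr_ge0 ?ltW.
(* For [t = 0] the quotient is 0 by convention: without violation the aligned multiplier is 0 and
   both sides vanish. *)
have normalize (r t : R) : r / t * t ^+ 2 = r * t.
  by have [->|t0] := eqVneq t 0; [ring | field].
have norm_mu m n (y : 'M[R]_(m, n)) (r : R) : 0 <= r ->
    norm2 ((r / norm2 y) *: y^T) ^+ 2 <= r ^+ 2.
  move=> r0; rewrite norm2Z norm2_tr normrM normfV !ger0_norm ?norm2_ge0//.
  have [->|y0] := eqVneq (norm2 y) 0; first by rewrite mulr0 expr0n sqr_ge0.
  by rewrite divfK.
have := primal_dual_gap k muL; rewrite /slack -(opprB _ b1) -(opprB _ b2).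
rewrite !pairingNr -/v -/w /mu/= !pairingZl pairing_trl pairing_pospart_tr !normalize.
have dmu : dnorm2sq mu <= 4 * (R1 ^+ 2 + R2 ^+ 2).
  have -> : 4 * (R1 ^+ 2 + R2 ^+ 2) = (2 * R1) ^+ 2 + (2 * R2) ^+ 2 by ring.
  by rewrite lerD// norm_mu// mulr_ge0// ltW.
have C0 : 0 < C k :> R := C_gt0 k.
have : L / (2 * C k) * dnorm2sq mu <= gap k.
  apply: (@le_trans _ _ (L / (2 * C k) * (4 * (R1 ^+ 2 + R2 ^+ 2)))).
    by rewrite ler_wpM2l// divr_ge0// mulr_ge0// ltW.
  have -> : L / (2 * C k) * (4 * (R1 ^+ 2 + R2 ^+ 2)) =
      8 * L * (R1 ^+ 2 + R2 ^+ 2) / (k.+1%:R * k.+2%:R).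
    have : k.+2%:R != 0 :> R by rewrite pnatr_eq0.
    have : k.+1%:R != 0 :> R by rewrite pnatr_eq0.
    rewrite sum_alpha; move: k.+1%:R k.+2%:R => a b a0 b0.
    by field; rewrite a0 b0.
  rewrite ler_wpM2l//.
    by rewrite mulr_ge0 ?(addr_ge0 (sqr_ge0 _) (sqr_ge0 _))// mulr_ge0.
  by rewrite lef_pV2 ?posrE ?mulr_gt0// expr2 ler_pM2l// ler_nat.
rewrite /infeas1 /infeas2 -/v -/w; lra.
Qed.

(** Let [s] be the weighted violation and [a = f (xhat k) + phi (eta k)]. Then [a + 2 * s <= gap k]
    and [- s <= f (xhat k) + phi lstar <= a], whence [s <= gap k] and all four bounds. The doubled
    radii are what leave one [s] over. *)
Lemma iterate_bounds k :
  [/\ `|f (xhat k) + phi (eta k)| <= gap k,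
      `|f (xhat k) + phi lstar| <= gap k,
      R1 * norm2 (A1 (xhat k) - b1) <= gap k &
      R2 * norm2 (pospart (A2 (xhat k) - b2)) <= gap k].
Proof.
have i1 : 0 <= R1 * infeas1 k by rewrite mulr_ge0 ?norm2_ge0// ltW.
have i2 : 0 <= R2 * infeas2 k by rewrite mulr_ge0 ?norm2_ge0// ltW.
have up := infeas_le_gap k; have lo := f_xhat_ge k.
have le_eta : phi lstar <= phi (eta k).
  by apply: lstar_min.2; case: (run.2 k) => -[].
rewrite !ler_norml; rewrite /infeas1 /infeas2 in i1 i2 up lo; split; lra.
Qed.

End Convergence.

(** * From rates to iteration counts *)

Lemma sqrt_div_le_natr (R : realType) (X e : R) n : 0 < e ->
  Num.sqrt (X / e) <= n.+1%:R -> X / n.+1%:R ^+ 2 <= e.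
Proof.
move=> e0 Xe; rewrite ler_pdivrMr ?exprn_gt0// mulrC -ler_pdivrMr//.
have [X0|X0] := leP 0 (X / e); last by rewrite (le_trans (ltW X0))// exprn_ge0.
by rewrite -(sqr_sqrtr X0) lerXn2r ?nnegrE ?sqrtr_ge0.
Qed.

(** The successor undoes the [- 1] in [iter_bound]; as [M <= |M - 1| + 1] for every integer [M], no
    sign condition is needed. *)
Lemma iter_boundP (R : realType) (c L R1 R2 ef eeq ein : R) :
  let n := (iter_bound c L R1 R2 ef eeq ein).+1%:R in
  [/\ Num.sqrt (c * L * (R1 ^+ 2 + R2 ^+ 2) / ef) <= n,
      Num.sqrt (8 * L * (R1 ^+ 2 + R2 ^+ 2) / (R1 * eeq)) <= n &
      Num.sqrt (8 * L * (R1 ^+ 2 + R2 ^+ 2) / (R2 * ein)) <= n].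
Proof.
rewrite /iter_bound /=; set x := Num.sqrt _; set y := Num.sqrt _; set z := Num.sqrt _.
set M := Num.max _ _.
have M_le : M%:~R <= (absz (M - 1)).+1%:R :> R.
  have := ler_norm (M - 1); rewrite -abszE -(ler_int R) intrB -natr1 lerBlDr.
  exact.
by split; apply: le_trans (ceil_ge _) (le_trans _ M_le);
  rewrite ler_int !le_max lexx ?orbT.
Qed.

Theorem theorem1 (R : realType) (E : normedVectType R) (m1 m2 : nat)
  (Q : set E) (f : E -> R) (nu : R)
  (A1 : {linear E -> 'cV[R]_m1}) (A2 : {linear E -> 'cV[R]_m2})
  (b1 : 'cV[R]_m1) (b2 : 'cV[R]_m2)
  (Q_nonempty : Q !=set0) (Q_closed : closed Q) (Q_convex : convex_set Q)
  (f_convex : convex_function Q f) (f_lsc : lsc_on Q f)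
  (nu_gt0 : 0 < nu) (f_strong : strongly_convex Q f nu)
  (xs : 'rV[R]_m1 * 'rV[R]_m2 -> E)
  (xs_sol : forall lam, Lambda lam -> is_argmax Q (inner_obj f A1 A2 lam) (xs lam))
  (R1 R2 : R) (R1_gt0 : 0 < R1) (R2_gt0 : 0 < R2)
  (dual_sol : exists lstar : 'rV[R]_m1 * 'rV[R]_m2,
    [/\ is_argmax (@Lambda R m1 m2) (dual_obj Q f A1 A2 b1 b2) lstar,
        norm2 lstar.1 <= R1 & norm2 lstar.2 <= R2])
  (L_gt0 : 0 < Lip A1 A2 nu)
  (lam eta zeta : nat -> 'rV[R]_m1 * 'rV[R]_m2)
  (run : fpdgm Q f A1 A2 b1 b2 nu lam eta zeta) :
  (forall ef eeq ein : R, 0 < ef -> 0 < eeq -> 0 < ein ->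
     exists k : nat,
       (k <= iter_bound 8 (Lip A1 A2 nu) R1 R2 ef eeq ein)%N /\
       stops_at Q f A1 A2 b1 b2 xs lam eta ef eeq ein k) /\
  (forall ef eeq ein : R, 0 < ef -> 0 < eeq -> 0 < ein ->
     let N := iter_bound 16 (Lip A1 A2 nu) R1 R2 ef eeq ein in
     let x := xhat xs lam N in
     [/\ (`| (f x)%:E - Opt Q f A1 A2 b1 b2 | <= ef%:E)%E,
         norm2 (A1 x - b1) <= eeq
       & norm2 (pospart (A2 x - b2)) <= ein]).
Proof.
have [lstar [[lL lmax] lstar1 lstar2]] := dual_sol.
have objE := dual_objE b1 b2 nu_gt0 f_strong xs_sol.
have lstar_min : is_argmin (@Lambda R m1 m2) (phi Q f A1 A2 b1 b2) lstar.
  by split=> // mu muL; rewrite -lerN2 -!objE//; exact: lmax.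
have bounds k := iterate_bounds Q_convex f_convex nu_gt0 f_strong xs_sol run
  R1_gt0 R2_gt0 lstar_min lstar1 lstar2 k.
have violations (k : nat) c ef eeq ein : 0 < eeq -> 0 < ein ->
    k = iter_bound c (Lip A1 A2 nu) R1 R2 ef eeq ein ->
    norm2 (A1 (xhat xs lam k) - b1) <= eeq /\
    norm2 (pospart (A2 (xhat xs lam k) - b2)) <= ein.
  move=> eeq0 ein0 ->.
  have [_ Neq Nin] := iter_boundP c (Lip A1 A2 nu) R1 R2 ef eeq ein.
  have [_ _ beq bin] := bounds (iter_bound c (Lip A1 A2 nu) R1 R2 ef eeq ein).
  split.
    rewrite -(ler_pM2l R1_gt0); apply: le_trans beq _.
    by apply: sqrt_div_le_natr Neq; rewrite mulr_gt0.
  rewrite -(ler_pM2l R2_gt0); apply: le_trans bin _.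
  by apply: sqrt_div_le_natr Nin; rewrite mulr_gt0.
split=> ef eeq ein ef0 eeq0 ein0.
  set N := iter_bound _ _ _ _ _ _ _.
  have stopN : stop_crit Q f A1 A2 b1 b2 xs lam eta ef eeq ein N.
    have [NA1 NA2] := violations N 8 ef eeq ein eeq0 ein0 erefl.
    split=> //; have [bN _ _ _] := bounds N; apply: le_trans bN _.
    by have [Nf _ _] := iter_boundP 8 (Lip A1 A2 nu) R1 R2 ef eeq ein;
      apply: sqrt_div_le_natr Nf.
  (* The criterion holds at [N], so a least index satisfying it exists and is at most [N]. *)
  have ex : exists k, `[< stop_crit Q f A1 A2 b1 b2 xs lam eta ef eeq ein k >].
    by exists N; apply/asboolP.
  have [k /asboolP stopk kmin] := ex_minnP ex.
  exists k; split; first by apply: kmin; apply/asboolP.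
  by split=> // j jk /asboolP/kmin; rewrite leqNgt jk.
move=> N x; have [NA1 NA2] := violations N 16 ef eeq ein eeq0 ein0 erefl.
split=> //; rewrite (strong_duality nu_gt0 f_strong xs_sol lstar_min).
rewrite -EFinB lee_fin opprK.
have [_ bN _ _] := bounds N; apply: le_trans bN _.
apply: sqrt_div_le_natr => //.
have [Nf _ _] := iter_boundP 16 (Lip A1 A2 nu) R1 R2 ef eeq ein.
(* The rate has constant 8, so the count with constant 16 is more than enough. *)
apply: le_trans Nf; rewrite ler_wsqrtr// ler_wpM2r ?invr_ge0 ?(ltW ef0)//.
rewrite ler_wpM2r ?addr_ge0 ?sqr_ge0// ler_wpM2r ?(ltW L_gt0)//.
by rewrite ler_nat.
Qed.
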